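(* (i) Let G be an abelian group of order 9m^4, where m is a positive odd integer with gcd(3,m)=1. If there exists a (9m^4, r(3m^2+1), -3m^2+r^2+3r, r^2+r) negative Latin square type partial difference set in G with r ≤ (3m^2-1)/2, then r ∈ {(3m^2-3)/4, (3m^2+1)/4, (3m^2+5)/4, (3m^2-5)/2, (3m^2-3)/2, (3m^2-1)/2}. (ii) Let G be an abelian group of order 9p^{4s}, where p is a prime with p ≡ 1 (mod 4) and s is an odd positive integer. If there exists a (9p^{4s}, r(3p^{2s}+1), -3p^{2s}+r^2+3r, r^2+r) negative Latin square type partial difference set in G with r ≤ (3p^{2s}-1)/2, then r ∈ {(3p^{2s}+1)/4, (3p^{2s}-1)/2, (3p^{2s}-3)/2}.
   Context: A subset D of a finite abelian group G is a (v,k,λ,μ) partial difference set (PDS) if |G|=v, |D|=k, and the differences gh^{-1} with g,h∈D distinct represent each non-identity element of D exactly λ times and each non-identity element of G not in D exactly μ times. A negative Latin square type PDS has parameters (n^2, r(n+1), -n+r^2+3r, r^2+r). The paper considers regular PDSs (D^{(-1)}=D, identity not in D); since the complement of a negative Latin square type PDS is again of that type, one may restrict to 1 ≤ r ≤ (n-1)/2. *)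

(* Defs.v *)
From mathcomp Require Import all_boot all_order all_algebra all_fingroup.
Set Implicit Arguments. Unset Strict Implicit. Unset Printing Implicit Defensive.
Import GRing.Theory Num.Theory.
Local Open Scope ring_scope.

Definition diff_count (gT : finGroupType) (D : {set gT}) (g : gT) : nat :=
  #|[set p in setX D D | (p.1 != p.2) && ((p.1 * p.2^-1)%g == g)]|.

(* D is a (v,k,lam,mu) partial difference set in the (finite) group G.
   lam, mu are integers since the NLS parameter -n+r^2+3r is a priori signed. *)
Definition is_PDS (gT : finGroupType) (G : {group gT}) (D : {set gT})
    (v k : nat) (lam mu : int) : Prop :=
  [/\ D \subset G, #|G| = v, #|D| = k &
    forall g, g \in G -> g != 1%g ->
      ((diff_count D g)%:Z) = (if g \in D then lam else mu)].

Definition is_regular_PDS (gT : finGroupType) (G : {group gT}) (D : {set gT})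
    (v k : nat) (lam mu : int) : Prop :=
  [/\ is_PDS G D v k lam mu, (D^-1)%g = D & (1%g \notin D)].

(* Main.v *)
Require Import Defs.
From mathcomp Require Import all_boot all_order all_algebra all_fingroup.
From mathcomp Require Import all_solvable all_field all_character.
From mathcomp Require Import ring zify.
Set Implicit Arguments. Unset Strict Implicit. Unset Printing Implicit Defensive.
Import Order.TTheory GRing.Theory Num.Theory.
Local Open Scope ring_scope.

(** Write n = 3m^2. Every nontrivial character of G sends D to r or r - n, so all
    character sums over D are integers and D is stable under x |-> x^s for s prime
    to |G|. Split G = N x M with |N| = m^4 and |M| = 9, and let F_y be the set of
    x in N with xy in D; F_y depends only on the cyclic group generated by y.

    If M is cyclic, comparing the characters of M trivial on its subgroup of order
    3 shows that every nontrivial character of N vanishes on the fibre F over a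
    generator. Hence F is empty or N, and its size contradicts 1 <= r <= (n-1)/2.

    If M is elementary abelian, a nontrivial character chi of N satisfies, with
    d = chi(F_1) and sums over y <> 1 in M,
      4 m^2 (r - d) - 3 sum |chi(F_y)|^2 - m^2 sum chi(F_y) >= 0.
    Summing over chi with the orthogonality relations, and expressing all |F_y|
    through r, the inequality leaves only 2r = n - 1 and 2r = n - 3. *)

(** * Fourier analysis on a finite abelian group *)

Section AbelianCharacters.

Variables (gT : finGroupType) (G : {group gT}).
Hypothesis cGG : abelian G.

Lemma abelian_irr_lin (i : Iirr G) : 'chi_i \is a linear_char.
Proof. by apply/char_abelianP. Qed.

Lemma sum_irr_conj_abelian x y : x \in G -> y \in G ->
  \sum_(i : Iirr G) 'chi_i x * ('chi_i y)^* = #|G|%:R *+ (x == y).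
Proof.
move=> Gx Gy; rewrite second_orthogonality_relation //.
have -> : (x \in y ^: G)%g = (x == y).
  apply/imsetP/eqP => [[z Gz ->]|->]; last by exists 1%g; rewrite ?conjg1.
  by rewrite conjgE (centsP cGG y Gy z Gz) mulKg.
by rewrite (setIidPl _) // sub_cent1 (subsetP cGG).
Qed.

(** Fourier inversion for the indicator function of [A]. *)
Lemma sum_irr_conj_set (A : {set gT}) y : A \subset G -> y \in G ->
  \sum_(i : Iirr G) (\sum_(x in A) 'chi_i x) * ('chi_i y)^* =
    #|G|%:R *+ (y \in A).
Proof.
move=> sAG Gy; under eq_bigr => i _ do rewrite mulr_suml.
rewrite exchange_big /=.
under eq_bigr => x Ax do rewrite sum_irr_conj_abelian ?(subsetP sAG x Ax) //.
case: (boolP (y \in A)) => [Ay | nAy].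
  rewrite (bigD1 y) //= eqxx big1 ?addr0 // => x /andP[_ /negPf->].
  by rewrite mulr0n.
by rewrite big1 // => x Ax; case: eqP => // eq_xy; rewrite eq_xy in Ax; rewrite Ax in nAy.
Qed.

Lemma sum_irr_set (A : {set gT}) : A \subset G ->
  \sum_(i : Iirr G) \sum_(x in A) 'chi_i x = #|G|%:R *+ (1%g \in A).
Proof.
move=> sAG; rewrite -sum_irr_conj_set //; apply: eq_bigr => i _.
by rewrite lin_char1 ?abelian_irr_lin // rmorph1 mulr1.
Qed.

(** Parseval's identity for the indicator function of [A]. *)
Lemma sum_irr_norm_set (A : {set gT}) : A \subset G ->
  \sum_(i : Iirr G) (\sum_(x in A) 'chi_i x) * (\sum_(x in A) 'chi_i x)^* =
    #|G|%:R * #|A|%:R.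
Proof.
move=> sAG; under eq_bigr => i _ do rewrite rmorph_sum mulr_sumr.
rewrite exchange_big /=.
under eq_bigr => x Ax do rewrite sum_irr_conj_set ?(subsetP sAG x Ax) // Ax mulr1n.
by rewrite sumr_const mulr_natr.
Qed.

Lemma irr0_sum_set (A : {set gT}) : A \subset G ->
  \sum_(x in A) 'chi[G]_0 x = #|A|%:R.
Proof.
move=> sAG; rewrite -sum1_card natr_sum; apply: eq_bigr => x Ax.
by rewrite irr0 cfun1E (subsetP sAG x Ax).
Qed.

Lemma irr_sum_eq0 (i : Iirr G) : i != 0 -> \sum_(x in G) 'chi_i x = 0.
Proof.
move=> nz_i; have := cfdot_irr i 0; rewrite (negPf nz_i) cfdotE.
move/eqP; rewrite mulf_eq0 invr_eq0 (negPf (neq0CG _)) /= => /eqP sum0.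
rewrite -[RHS]sum0.
by apply: eq_bigr => x Gx; rewrite irr0 cfun1E Gx rmorph1 mulr1.
Qed.

(* The automorphism z |-> z ^+ s of the #|G|-th roots of unity fixes the integral
   sums, so A and its image under s-th powers have the same Fourier transform. *)
Lemma rational_set_expg (A : {set gT}) s : A \subset G -> coprime s #|G| ->
  (forall i : Iirr G, \sum_(x in A) 'chi_i x \in Num.int) ->
  forall x, x \in A -> (x ^+ s)%g \in A.
Proof.
move=> sAG co_s intA x Ax; have [u Du] := Qn_aut_exists co_s.
have Gx := subsetP sAG x Ax.
have uE (i : Iirr G) z : z \in G -> u ('chi_i z) = 'chi_i (z ^+ s)%g.
  move=> Gz; rewrite lin_charX ?abelian_irr_lin // Du //.
  by rewrite -lin_charX ?abelian_irr_lin // expg_cardG // lin_char1 ?abelian_irr_lin.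
have uA (i : Iirr G) :
    \sum_(z in A) 'chi_i (z ^+ s)%g = \sum_(z in A) 'chi_i z.
  have /intrP[k Dk] := intA i.
  rewrite [RHS]Dk -(rmorph_int u) -Dk rmorph_sum.
  by apply: eq_bigr => z Az; rewrite uE ?(subsetP sAG z Az).
(* Inversion at x^s counts the z in [A] with z^s = x^s. By [uA] the same sum is |G| or 0 according
   to whether x^s lies in [A]; it is not 0, since z = x is counted. *)
have: \sum_(i : Iirr G) (\sum_(z in A) 'chi_i (z ^+ s)%g) * ('chi_i (x ^+ s)%g)^*
    = #|G|%:R *+ #|[set z in A | (z ^+ s == x ^+ s)%g]|.
  under eq_bigr => i _ do rewrite mulr_suml.
  rewrite exchange_big /= -sum1dep_card -mulr_natr natr_sum mulr_sumr.
  rewrite [RHS]big_mkcondr /=; apply: eq_bigr => z Az.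
  by rewrite sum_irr_conj_abelian ?groupX ?(subsetP sAG z Az) // mulr1; case: eqP.
under eq_bigr => i _ do rewrite uA.
rewrite sum_irr_conj_set ?groupX //; case: (boolP ((x ^+ s)%g \in A)) => // _ /esym/eqP.
rewrite mulr0n -mulr_natr mulf_eq0 (negPf (neq0CG _)) /= pnatr_eq0 cards_eq0.
by move/eqP/setP/(_ x); rewrite !inE Ax eqxx.
Qed.

(** The character has kernel [H]: it is 1 on [H], and off [H] its values are primitive cube roots of
    unity w, with w + w^-1 = -1. As f is even, pairing y with y^-1 turns twice the sum into 2 (sum
    of f over H) - (sum of f off H). *)
Lemma index3_character (H : {group gT}) : H \subset G -> #|G : H|%g = 3%N ->
  exists2 i : Iirr G, i != 0 & forall f : gT -> algC,
    (forall y, y \in G -> f y^-1%g = f y) ->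
    2 * \sum_(y in G) f y * 'chi_i y =
      3 * \sum_(y in H) f y - \sum_(y in G) f y.
Proof.
move=> sHG iHG.
have nHG : (H <| G)%g by rewrite -sub_abelian_normal.
have oQ : #|(G / H)%g| = 3%N by rewrite card_quotient ?normal_norm.
have cQQ : abelian (G / H) by rewrite quotient_abelian.
have [j nz_j] : exists j : Iirr (G / H), j != 0.
  have nQ : Nirr (G / H) = 3%N.
    by rewrite NirrE; move: cQQ; rewrite card_classes_abelian oQ => /eqP.
  by exists (cast_ord (esym nQ) (Ordinal (isT : 1 < 3)%N)); rewrite -val_eqE.
exists (mod_Iirr j); first by rewrite mod_Iirr_eq0.
have linj : 'chi_j \is a linear_char by apply/char_abelianP.
set psi := 'chi_(mod_Iirr j).
have psiE y : y \in G -> psi y = 'chi_j (coset H y).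
  by move=> Gy; rewrite /psi mod_IirrE // cfModE.
have psiH y : y \in H -> psi y = 1.
  by move=> Hy; rewrite psiE ?(subsetP sHG) // coset_id // lin_char1.
have psi_nH y : y \in G -> y \notin H -> psi y + psi y^-1%g = - 1.
  move=> Gy nHy; have Ny := subsetP (normal_norm nHG) y Gy.
  have Qy : coset H y \in (G / H)%g by rewrite mem_quotient.
  rewrite !psiE ?groupV // morphV // lin_charV //.
  set w := 'chi_j _.
  have w3 : w ^+ 3 = 1 by rewrite /w -lin_charX // -oQ expg_cardG // lin_char1.
  have w1 : w != 1.
    apply: contra nz_j => /eqP w1; rewrite -irr_eq1; apply/eqP/cfun_inP => z Qz.
    have : (G / H)%g :=: <[coset H y]>%g.
      apply/esym/eqP; rewrite eqEcard cycle_subG Qy /= oQ -orderE.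
      have : (#[coset H y]%g %| 3)%N by rewrite -oQ order_dvdG.
      rewrite dvdn_divisors // (_ : divisors 3 = [:: 1; 3])%N // !inE.
      case/orP=> [|/eqP-> //]; rewrite order_eq1 => /eqP cy1.
      by case/negP: nHy; apply: coset_idr.
    move=> genQ; have /cycleP[k ->] : z \in <[coset H y]>%g by rewrite -genQ.
    rewrite lin_charX // -/w w1 expr1n cfun1E.
    by rewrite groupX.
  have w0 : w != 0 by rewrite lin_char_neq0.
  have := subrX1 w 3; rewrite w3 subrr => /esym/eqP.
  rewrite mulf_eq0 subr_eq0 (negPf w1) /= !big_ord_recl big_ord0 /= => /eqP w210.
  apply: (mulfI w0); rewrite mulrDr mulfV // mulrN mulr1.
  apply/eqP; rewrite -subr_eq0 -[X in _ == X]w210; apply/eqP; rewrite /bump /=; ring.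
move=> f fV.
have -> : 2 * \sum_(y in G) f y * psi y =
    \sum_(y in G) f y * (psi y + psi y^-1%g).
  under [RHS]eq_bigr => y _ do rewrite mulrDr.
  rewrite big_split /= mulr2n mulrDl mul1r; congr (_ + _).
  rewrite [RHS](reindex_inj invg_inj) /=; apply: eq_big => [y|y Gy].
    by rewrite groupV.
  by rewrite invgK fV.
rewrite (big_setID H) [\sum_(y in G) f y](big_setID H) /= (setIidPr sHG).
have -> : \sum_(y in H) f y * (psi y + psi y^-1%g) = 2 * \sum_(y in H) f y.
  by rewrite mulr_sumr; apply: eq_bigr => y Hy; rewrite !psiH ?groupV // mulrC.
have -> : \sum_(y in G :\: H) f y * (psi y + psi y^-1%g) = - \sum_(y in G :\: H) f y.
  rewrite -sumrN; apply: eq_bigr => y /setDP[Gy nHy].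
  by rewrite psi_nH // mulrN1.
ring.
Qed.

End AbelianCharacters.

(** * Character values of a partial difference set *)

Section PDSCharacters.

Variables (gT : finGroupType) (G : {group gT}) (D : {set gT}).
Hypothesis cGG : abelian G.

(** Since D = D^-1, the square is the sum of chi(g h^-1) over pairs in D. The diagonal contributes
    k; the other pairs are grouped by their difference, and chi sums to -1 over the nonidentity
    elements. *)
Lemma PDS_char_quadratic v k lam mu (i : Iirr G) :
    is_regular_PDS G D v k lam mu -> i != 0 ->
  (\sum_(g in D) 'chi_i g) ^+ 2 =
    (k%:R - mu%:~R) + (lam - mu)%:~R * \sum_(g in D) 'chi_i g.
Proof.
move=> [[sDG oG oD cntD] DV nD1] nz_i.
have lin_i := abelian_irr_lin cGG i.
set X := \sum_(g in D) _.
have -> : X ^+ 2 = \sum_(p in setX D D) 'chi_i (p.1 * p.2^-1)%g.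
  have XV : X = \sum_(g in D) 'chi_i g^-1%g.
    rewrite /X (reindex_inj invg_inj) /=; apply: eq_bigl => g.
    by rewrite -{2}DV inE.
  rewrite expr2 {2}XV /X mulr_suml.
  rewrite (eq_bigl (fun p => (p.1 \in D) && (p.2 \in D))); last first.
    by case=> g h; rewrite inE.
  rewrite -(pair_big (mem D) (mem D) (fun g h => 'chi_i (g * h^-1)%g)) /=.
  apply: eq_bigr => g Dg; rewrite mulr_sumr; apply: eq_bigr => h Dh.
  by rewrite lin_charM // ?groupV (subsetP sDG).
rewrite (bigID (fun p => p.1 == p.2)) /=.
have -> : \sum_(p in setX D D | p.1 == p.2) 'chi_i (p.1 * p.2^-1)%g = k%:R.
  rewrite (reindex_onto (fun g => (g, g)) fst) /=; last first.
    by move=> [g h] /andP[_ /eqP /= ->].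
  rewrite -oD -sum1_card natr_sum; apply: eq_big => [g|g _].
    by rewrite inE /= !eqxx !andbT andbb.
  by rewrite mulgV lin_char1.
rewrite (partition_big (fun p => (p.1 * p.2^-1)%g) (mem (G :\ 1%g))) /=; last first.
  move=> [g h] /=; rewrite !inE /= => /andP[/andP[Dg Dh] ngh].
  by rewrite -eq_mulgV1 ngh groupM // ?groupV (subsetP sDG).
rewrite (eq_bigr (fun g => mu%:~R * 'chi_i g + (lam - mu)%:~R * ('chi_i g *+ (g \in D))));
  last first.
  move=> g /setD1P[ng1 Gg].
  transitivity ((diff_count D g)%:Z%:~R * 'chi_i g).
    rewrite /diff_count -sum1_card -pmulrn natr_sum mulr_suml.
    apply: eq_big => [p|p /andP[_ /eqP->]]; first by rewrite !inE andbA.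
    by rewrite mul1r.
  rewrite cntD //; case: (g \in D); rewrite ?mulr1n ?mulr0n ?mulr0 ?addr0 //.
  by rewrite intrD intrN; ring.
rewrite big_split /= -!mulr_sumr.
have -> : \sum_(g in G :\ 1%g) 'chi_i g = -1.
  have := irr_sum_eq0 nz_i; rewrite (bigD1 1%g) //= lin_char1 // => /eqP.
  rewrite addrC addr_eq0 => /eqP <-; apply: eq_bigl => g.
  by rewrite !inE andbC.
have -> : \sum_(g in G :\ 1%g) 'chi_i g *+ (g \in D) = X.
  rewrite /X big_mkcond [RHS]big_mkcond /=; apply: eq_bigr => g _; rewrite !inE.
  case Dg: (g \in D); last by rewrite if_same.
  by rewrite (subsetP sDG) // andbT; case: eqP Dg nD1 => // -> ->.
ring.
Qed.

(** For these parameters the quadratic factors as (X - r)(X - (r - n)) = 0. *)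
Lemma NLS_char_value v n r (i : Iirr G) :
    is_regular_PDS G D v (r * (n + 1)) (- n%:Z + (r ^ 2)%:Z + (3 * r)%:Z)
      (r ^ 2 + r)%:Z ->
    i != 0 ->
  \sum_(g in D) 'chi_i g = r%:R \/ \sum_(g in D) 'chi_i g = r%:R - n%:R.
Proof.
move=> pdsD nz_i; have := PDS_char_quadratic pdsD nz_i.
set X := \sum_(g in D) _ => eqX.
suff /eqP : (X - r%:R) * (X - (r%:R - n%:R)) = 0.
  by rewrite mulf_eq0 !subr_eq0 => /orP[]/eqP; [left | right].
transitivity (X ^+ 2 - (2 * r%:R - n%:R) * X + r%:R * (r%:R - n%:R)); first ring.
by rewrite eqX !PoszD !PoszM !(rmorphD, rmorphB, rmorphN, rmorphM) /=; ring.
Qed.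

Lemma NLS_char_int v n r (i : Iirr G) :
    is_regular_PDS G D v (r * (n + 1)) (- n%:Z + (r ^ 2)%:Z + (3 * r)%:Z)
      (r ^ 2 + r)%:Z ->
  \sum_(g in D) 'chi_i g \in Num.int.
Proof.
move=> pdsD; have [[sDG _ _ _] _ _] := pdsD.
have [->|nz_i] := eqVneq i 0; first by rewrite irr0_sum_set // natr_int.
by have [->|->] := NLS_char_value pdsD nz_i; rewrite ?rpredB ?natr_int.
Qed.

End PDSCharacters.


(** * Slices of D along a direct product N x M *)

Section Fibres.

Variables (gT : finGroupType) (N M G : {group gT}) (D : {set gT}).
Hypotheses (defG : (N \x M = G)%g) (sDG : D \subset G).

Definition fibre y : {set gT} := [set x in N | (x * y)%g \in D].

Definition fibre_char (i : Iirr N) y : algC := \sum_(x in fibre y) 'chi_i x.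

Lemma fibre_sub y : fibre y \subset N.
Proof. by apply/subsetP => x /setIdP[]. Qed.

Lemma fibre_char0 y : fibre_char 0 y = #|fibre y|%:R.
Proof. by rewrite /fibre_char irr0_sum_set ?fibre_sub. Qed.

Lemma fibre_char_Aint i y : fibre_char i y \in Aint.
Proof. by rewrite rpred_sum // => x _; apply: Aint_irr. Qed.

(** Turns the known character values of D into linear relations between the fibre sums. *)
Lemma sum_dprod_fibre (i : Iirr N) (j : Iirr M) :
  \sum_(g in D) 'chi_(dprod_Iirr defG (i, j)) g =
    \sum_(y in M) fibre_char i y * 'chi_j y.
Proof.
transitivity (\sum_(g in G) 'chi_(dprod_Iirr defG (i, j)) g *+ (g \in D)).
  rewrite big_mkcond [RHS]big_mkcond /=; apply: eq_bigr => g _.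
  by case Dg: (g \in D); rewrite ?if_same // (subsetP sDG).
rewrite (reindex_dprod defG) /= exchange_big /=; apply: eq_bigr => y My.
rewrite /fibre_char mulr_suml big_mkcond [RHS]big_mkcond /=.
apply: eq_bigr => x _; rewrite inE; case: (boolP (x \in N)) => //= Nx.
by rewrite dprod_IirrE cfDprodE //; case: (_ \in D).
Qed.

(** By the Chinese remainder theorem some exponent t is 1 modulo |N| and s modulo |M|; the t-th
    power sends xy to x y^s and preserves D. *)
Lemma fibre_expg y s : coprime #|N| #|M| -> y \in M -> coprime s #|M| ->
    (forall t x, coprime t #|G| -> x \in D -> (x ^+ t)%g \in D) ->
  fibre y \subset fibre (y ^+ s)%g.
Proof.
move=> coNM My co_s powD; apply/subsetP => x /setIdP[Nx Dxy].
rewrite inE Nx /=; pose t := chinese #|N| #|M| 1 s.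
have tN : t = 1 %[mod #|N|] by apply: chinese_modl.
have tM : t = s %[mod #|M|] by apply: chinese_modr.
have co_t : coprime t #|G|.
  rewrite -(dprod_card defG) coprimeMr -(coprime_modl t #|N|) -(coprime_modl t #|M|).
  by rewrite tN tM !coprime_modl coprime1n.
have [_ _ cMN _] := dprodP defG.
have := powD t _ co_t Dxy; rewrite expgMn; last exact/commute_sym/(centsP cMN).
rewrite -(expg_mod t (expg_cardG Nx)) tN (expg_mod 1 (expg_cardG Nx)) expg1.
by rewrite -(expg_mod t (expg_cardG My)) tM (expg_mod s (expg_cardG My)).
Qed.

End Fibres.

(** * Integer arithmetic for the elementary abelian case *)

Lemma NLS_final_arith (q b eps r : int) :
  odd `|q| -> 25 <= q -> 0 <= eps <= 4 -> 1 <= r -> 2 * r <= 3 * q - 1 ->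
  r = 3 * b - eps -> 0 <= 6 * b * (2 * b - q + 1 - eps) + q * eps ->
  2 * r = 3 * q - 1 \/ 2 * r = 3 * q - 3.
Proof.
move=> odd_q q_ge /andP[e_ge e_le] r_ge r_le rE ineq.
have [q' qE] : exists q', q = 2 * q' + 1 by exists (q %/ 2)%Z; lia.
(* Write c = q - 2b - 1 + eps. The last hypothesis reads 6bc <= q eps, which fails for c >= 2
   because eps <= 4. *)
have c_lt : q - 2 * b - 1 + eps < 2.
  rewrite ltNge; apply/negP => c_ge.
  have b_ge : 1 <= b by lia.
  have : 0 <= (q - 2 * b - 1 + eps - 2) * (2 * b - 2) by apply: mulr_ge0; lia.
  nia.
have c_ge : 0 <= q - 2 * b - 1 + eps by lia.
(* For c = 0, eps is even as q is odd, and 2r = 3q - 3 + eps; the bound on r leaves eps = 0 or 2. *)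
have [c0|c1] : q - 2 * b - 1 + eps = 0 \/ q - 2 * b - 1 + eps = 1 by lia.
  lia.
(* For c = 1, eps is odd and q = 2b + 2 - eps, so 6b <= q eps fails for both values. *)
have : eps = 1 \/ eps = 3 by lia.
by case=> eE; subst eps; nia.
Qed.

Lemma coprime6_sqr_dvdz (m : nat) (z : int) :
  odd m -> coprime 3 m -> ((m ^ 2)%:Z %| 6 * z)%Z -> ((m ^ 2)%:Z %| z)%Z.
Proof.
move=> odd_m co3m; rewrite Gauss_dvdzr // coprimezE /= coprimeXl //.
by rewrite (@coprimeMr m 2 3) coprimen2 odd_m coprime_sym.
Qed.

(** A rational algebraic integer is an integer. *)
Lemma Aint_natmul_int (k : nat) (z : int) (x : algC) :
  x \in Aint -> (0 < k)%N -> k%:R * x = z%:~R -> (k%:Z %| z)%Z /\ x = (z %/ k%:Z)%Z%:~R.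
Proof.
move=> Ax k_gt0 kx; have k0 : k%:R != 0 :> algC by rewrite pnatr_eq0 -lt0n.
have xE : x = z%:~R / k%:R by apply: (mulfI k0); rewrite kx mulrCA mulfV ?mulr1.
have /intrP[w wE] : x \in Num.int.
  by apply: Cint_rat_Aint => //; rewrite xE rpred_div ?rpred_int ?rpred_nat.
have zE : z = w * k%:Z.
  by apply/eqP; rewrite -(eqr_int algC) -kx wE intrM mulrC.
by rewrite zE dvdz_mull // mulzK //; lia.
Qed.

(* The bound is 12 t (t - q) in the first case, nonnegative because q divides t,
   and 12 (t + q)^2 in the second. *)
Lemma fibre_ineq_step (r q s0 t d : int) (T : finType) (A : {set T}) (e del : T -> int) :
  #|A| = 8%N ->
  d = s0 - 2 * t -> (forall y, y \in A -> e y = t - del y) ->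
  6 * t = \sum_(y in A) del y ->
  (q %| t)%Z ->
  (s0 = r /\ forall y, y \in A -> del y = 0 \/ del y = q) \/
  (s0 = r - 3 * q /\ forall y, y \in A -> del y = 0 \/ del y = - q) ->
  0 <= 4 * (r - d) * q - 3 * (\sum_(y in A) e y ^+ 2) - 2 * t * q.
Proof.
move=> oA dE eE tE /dvdzP[tau tauE] cases.
(* Here del^2 = sg q del, so the sum of squares depends on [del] only through its sum 6t. *)
have sq (sg : int) : (forall y, y \in A -> del y = 0 \/ del y = sg * q) ->
    \sum_(y in A) e y ^+ 2 = - 4 * t ^+ 2 + 6 * sg * q * t.
  move=> delE.
  transitivity (\sum_(y in A) (t ^+ 2 + (sg * q - 2 * t) * del y)).
    by apply: eq_bigr => y Ay; rewrite eE //; case: (delE y Ay) => ->; ring.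
  rewrite big_split /= sumr_const oA -mulr_sumr -tE -mulr_natr; ring.
case: cases => -[s0E delE].
  rewrite (sq 1); last by move=> y /delE; rewrite mul1r.
  rewrite dE s0E tauE.
  have -> : 4 * (r - (r - 2 * (tau * q))) * q -
     3 * (-4 * (tau * q) ^+ 2 + 6 * 1 * q * (tau * q)) - 2 * (tau * q) * q =
     12 * (q ^+ 2 * (tau * (tau - 1))) by ring.
  by rewrite mulr_ge0 // mulr_ge0 ?sqr_ge0 //; nia.
rewrite (sq (-1)); last by move=> y /delE; rewrite mulN1r.
rewrite dE s0E.
have -> : 4 * (r - (r - 3 * q - 2 * t)) * q -
    3 * (-4 * t ^+ 2 + 6 * -1 * q * t) - 2 * t * q = 12 * (t + q) ^+ 2 by ring.
by rewrite mulr_ge0 ?sqr_ge0.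
Qed.

(** * Fibres over a subgroup M of order 9 *)

Section NLS.

Variables (gT : finGroupType) (G N M : {group gT}) (D : {set gT}) (m r : nat).
Hypotheses (cGG : abelian G) (defG : (N \x M = G)%g).
Hypotheses (oM : #|M| = 9%N) (oN : #|N| = (m ^ 4)%N).
Hypotheses (m_gt0 : (0 < m)%N) (odd_m : odd m) (co3m : coprime 3 m).
Hypotheses (r_gt0 : (0 < r)%N) (r_le : (2 * r <= 3 * m ^ 2 - 1)%N).
Hypothesis pdsD :
  is_regular_PDS G D (9 * m ^ 4) (r * (3 * m ^ 2 + 1))
       (- (3 * m ^ 2)%:Z + (r ^ 2)%:Z + (3 * r)%:Z) ((r ^ 2 + r)%:Z).

Local Notation F := (fibre N D).
Local Notation e := (@fibre_char gT N D).

Let sDG : D \subset G. Proof. by case: pdsD => [[]]. Qed.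
Let oD : #|D| = (r * (3 * m ^ 2 + 1))%N. Proof. by case: pdsD => [[]]. Qed.
Let nD1 : 1%g \notin D. Proof. by case: pdsD. Qed.
Let cNN : abelian N.
Proof. by apply: abelianS cGG; have [_ <- _ _] := dprodP defG; apply: mulG_subl. Qed.
Let cMM : abelian M.
Proof. by apply: abelianS cGG; have [_ <- _ _] := dprodP defG; apply: mulG_subr. Qed.
Let coNM : coprime #|N| #|M|.
Proof. by rewrite oN oM coprimeXl // (@coprimeXr 2 m 3) // coprime_sym. Qed.

Lemma fibre_subX y s : y \in M -> coprime s 9 -> F y \subset F (y ^+ s)%g.
Proof.
move=> My co_s; apply: (fibre_expg defG) => //; first by rewrite oM.
move=> t x co_t; apply: (rational_set_expg cGG) => // i.
exact: NLS_char_int pdsD.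
Qed.

(** The symmetry of D would only relate the fibre over y^-1 to the inverse of [F y]. Equality comes
    from power stability: exponent 8 is prime to 9 and inverts M. *)
Lemma fibreV y : y \in M -> F y^-1%g = F y.
Proof.
have sub z : z \in M -> F z \subset F z^-1%g.
  move=> Mz; have <- : (z ^+ 8 = z^-1)%g; last exact: fibre_subX.
  by apply: (mulgI z); rewrite mulgV -expgS -oM expg_cardG.
move=> My; apply/eqP; rewrite eqEsubset sub // andbT.
by rewrite -{2}[y]invgK sub ?groupV.
Qed.

Let eigen (x : algC) := x = r%:R \/ x = r%:R - (3 * m ^ 2)%:R.

Lemma sum_fibres_eigen (i : Iirr N) : i != 0 -> eigen (\sum_(y in M) e i y).
Proof.
move=> nz_i; have -> : \sum_(y in M) e i y =
    \sum_(g in D) 'chi_(dprod_Iirr defG (i, 0)) g.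
  rewrite sum_dprod_fibre //; apply: eq_bigr => y My.
  by rewrite irr0 cfun1E My mulr1.
apply: (NLS_char_value cGG pdsD).
by rewrite dprod_Iirr_eq0 (negPf nz_i).
Qed.

Lemma sum_fibres_card : (\sum_(y in M) #|F y| = r * (3 * m ^ 2 + 1))%N.
Proof.
apply/eqP; rewrite -(eqr_nat algC) natr_sum -oD; apply/eqP.
have <- := irr0_sum_set sDG; rewrite -(dprod_Iirr0 defG) sum_dprod_fibre //.
by apply: eq_bigr => y My; rewrite fibre_char0 irr0 cfun1E My mulr1.
Qed.

(** The character of M is nontrivial, so [i] may be trivial; [i] = 0 yields the relations between
    fibre sizes. *)
Lemma index3_eigen (i : Iirr N) (H : {group gT}) :
    H \subset M -> #|M : H|%g = 3%N ->
  exists2 X, eigen X & 2 * X = 3 * \sum_(y in H) e i y - \sum_(y in M) e i y.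
Proof.
move=> sHM iHM; have [j nz_j jE] := index3_character cMM sHM iHM.
exists (\sum_(y in M) e i y * 'chi_j y); last first.
  by rewrite jE // => y My; rewrite /fibre_char fibreV.
rewrite -(sum_dprod_fibre defG) //; apply: (NLS_char_value cGG pdsD).
by rewrite dprod_Iirr_eq0 (negPf nz_j) andbF.
Qed.

(** The range of z settles the cyclic case; the two sign statements separate the cases of
    [fibre_ineq_step]. *)
Lemma eigen_diff x y : eigen x -> eigen y ->
  exists2 z : int, x - y = (3 * (m ^ 2)%:Z * z)%:~R &
    [/\ z = 0 \/ z = 1 \/ z = -1, x = r%:R -> z = 0 \/ z = 1 &
        x = r%:R - (3 * m ^ 2)%:R -> z = 0 \/ z = - 1].
Proof.
have nz : (3 * m ^ 2)%:R != 0 :> algC by rewrite pnatr_eq0; lia.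
have ne : r%:R <> r%:R - (3 * m ^ 2)%:R :> algC.
  move=> /esym/eqP; rewrite -subr_eq0 addrAC subrr add0r oppr_eq0; exact/negP.
case=> ->; case=> ->.
- by exists 0; [rewrite mulr0 subrr | split=> //; left].
- exists 1; first by rewrite mulr1 intrM; ring.
  by split=> //; [right; left | right].
- exists (-1); first by rewrite mulrN1 intrN intrM; ring.
  by split=> //; [right; right | move=> /esym/ne | right].
- by exists 0; [rewrite mulr0 subrr | split=> //; left].
Qed.

Lemma no_order9 y : y \in M -> #[y]%g = 9%N -> False.
Proof.
move=> My oy.
have genM : <[y]>%g = M.
  by apply/eqP; rewrite eqEcard cycle_subG My /= oM -orderE oy.
pose H := <[y ^+ 3]>%G.
have sHM : H \subset M by rewrite cycle_subG groupX.
have oH : #|H| = 3%N by rewrite -orderE orderXdiv oy.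
have iHM : #|M : H|%g = 3%N by rewrite -divgS // oM oH.
(* The elements off [H] are the generators of M, that is, the powers y^k with k prime to 9. *)
have Fgen z : z \in M :\: H -> F z = F y.
  case/setDP; rewrite -genM => /cycleP[k ->{z}] nHk.
  have co_k : coprime k 9.
    rewrite (@coprimeXr 2 k 3) // coprime_sym prime_coprime //.
    apply: contra nHk => /dvdnP[l ->]; rewrite mulnC expgM.
    by rewrite mem_cycle.
  apply/eqP; rewrite eqEsubset fibre_subX // andbT.
  have k6 : (k ^ 6 = 1 %[mod 9])%N by apply: (Euler_exp_totient co_k).
  (* The totient of 9 is 6, so k^5 inverts k modulo 9. *)
  have {2}-> : y = ((y ^+ k) ^+ (k ^ 5))%g.
    rewrite -expgM -expnS -(expg_mod (k ^ 6) (expg_cardG My)) oM k6.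
    by rewrite -oM (expg_mod 1 (expg_cardG My)) expg1.
  by apply: fibre_subX; rewrite ?groupX ?coprimeXl.
have key (i : Iirr N) : exists2 X, eigen X & \sum_(z in M) e i z - X = 9 * e i y.
  have [X eigX XE] := index3_eigen i sHM iHM; exists X => //.
  have eM : \sum_(z in M) e i z = \sum_(z in H) e i z + 6 * e i y.
    rewrite (big_setID H) /= (setIidPr sHM); congr (_ + _).
    rewrite (eq_bigr (fun=> e i y)); last by move=> z /Fgen Fz; rewrite /fibre_char Fz.
    by rewrite sumr_const cardsD (setIidPr sHM) oM oH [RHS]mulr_natl.
  have n2 : 2 != 0 :> algC by rewrite pnatr_eq0.
  apply: (mulfI n2); rewrite mulrBr XE eM; ring.
(* Here 9 e = 3 m^2 z with e an integer, so 3 divides z, and |z| <= 1 forces z = 0. *)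
have e0 (i : Iirr N) : i != 0 -> e i y = 0.
  move=> nz_i; have [X eigX XE] := key i.
  have [z zE [zP _ _]] := eigen_diff (sum_fibres_eigen nz_i) eigX.
  have [dv ->] := Aint_natmul_int (k := 9) (fibre_char_Aint _ _ _) isT
    (etrans (esym XE) zE).
  have : (3 %| (m ^ 2)%:Z * z)%Z.
    by move: dv; rewrite (_ : 9%:Z = 3 * 3) // -mulrA dvdz_mul2l.
  rewrite Gauss_dvdzr; last by rewrite coprimezE coprimeXr.
  by case: zP => [->|[]->]; rewrite ?mulr0 ?div0z.
(* Only the trivial character survives in the inversion formula, so the indicator of [F y] is
   constant on N. *)
have Fall x : x \in N -> #|F y|%:R = #|N|%:R *+ (x \in F y) :> algC.
  move=> Nx; rewrite -(sum_irr_conj_set cNN (fibre_sub N D y) Nx).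
  rewrite (bigD1 0) //= [X in _ = _ + X]big1; last first.
    by move=> i nz_i; rewrite -/(fibre_char D i y) e0 ?mul0r.
  by rewrite irr0_sum_set ?fibre_sub // irr0 cfun1E Nx rmorph1 mulr1 addr0.
have oF : #|F y| = 0%N \/ #|F y| = (m ^ 4)%N.
  have [F0|[x Fx]] := set_0Vmem (F y); first by left; rewrite F0 cards0.
  right; have /setIdP[Nx _] := Fx; apply/eqP; rewrite -oN -(eqr_nat algC).
  by rewrite (Fall x Nx) Fx.
have [X eigX] := key 0.
have -> : \sum_(z in M) e 0 z = (r * (3 * m ^ 2 + 1))%:R.
  by rewrite -sum_fibres_card natr_sum; apply: eq_bigr => z _; rewrite fibre_char0.
rewrite fibre_char0 => XE.
have m2_gt0 : (0 < m ^ 2)%N by rewrite expn_gt0 m_gt0.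
have m4E : (m ^ 4 = m ^ 2 * m ^ 2)%N by rewrite -expnD.
(* The trivial character in [key], with X = r or X = r - n. A fibre of size 0 or m^4 would make r or
   r + 1 equal to 0 or n. *)
have : (r * (3 * m ^ 2) = 9 * #|F y| \/ (r + 1) * (3 * m ^ 2) = 9 * #|F y|)%N.
  case: eigX XE => -> XE; [left | right]; apply/eqP; rewrite -(eqr_nat algC) natrM -?XE;
    apply/eqP; rewrite [RHS]natrM -XE !(natrM, natrD); ring.
by case: oF => ->; rewrite ?m4E; nia.
Qed.

(** * The elementary abelian case *)

Lemma order3 y : y \in M :\ 1%g -> #[y]%g = 3%N.
Proof.
case/setD1P=> ny1 My; have := order_dvdG My; rewrite oM => dv.
have : #[y]%g \in divisors 9 by rewrite -dvdn_divisors.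
rewrite (_ : divisors 9 = [:: 1; 3; 9])%N // !inE order_eq1 (negPf ny1) /=.
by case/orP=> /eqP // /(no_order9 My).
Qed.

(** Apply [index3_eigen] to {1, y, y^-1}; the fibre sums at y and y^-1 agree. *)
Lemma order3_eigen (i : Iirr N) y : y \in M :\ 1%g ->
  exists2 X, eigen X &
    2 * X = 2 * e i 1%g + 6 * e i y - \sum_(z in M :\ 1%g) e i z.
Proof.
move=> My1; have oy := order3 My1; have /setD1P[ny1 My] := My1.
have sHM : <[y]>%G \subset M by rewrite cycle_subG.
have iHM : #|M : <[y]>%G|%g = 3%N by rewrite -divgS // oM -orderE oy.
have [X eigX XE] := index3_eigen i sHM iHM; exists X => //; rewrite XE.
rewrite (bigD1 1%g (P := mem M)) //=.
rewrite [\sum_(z in M :\ 1%g) _](eq_bigl (fun z => (z \in M) && (z != 1%g)));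
  last first.
  by move=> z; rewrite !inE andbC.
have -> : \sum_(z in <[y]>%g) e i z = e i 1%g + 2 * e i y.
  have yV : (y ^+ 2 = y^-1)%g.
    by apply: (mulgI y); rewrite mulgV -expgS -oy expg_order.
  have nyV : (y^-1)%g != y.
    apply: contra ny1; rewrite -yV => /eqP y2.
    by apply/eqP/(mulgI y); rewrite mulg1 -{3}y2 expgS expg1.
  have -> : <[y]>%g = 1%g |: [set y; y^-1%g].
    apply/esym/eqP; rewrite eqEcard -orderE oy !subUset !sub1set group1.
    rewrite groupV cycle_id /=.
    by rewrite cardsU1 cards2 !inE !(eq_sym 1%g) invg_eq1 (negPf ny1) eq_sym nyV.
  rewrite big_setU1 ?inE; last by rewrite negb_or !(eq_sym 1%g) invg_eq1 ny1.
  rewrite big_setU1 /=; last by rewrite inE eq_sym.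
  rewrite big_set1 /fibre_char fibreV //; ring.
ring.
Qed.


Lemma card_M1 : #|M :\ 1%g| = 8%N.
Proof. by have := cardsD1 1%g M; rewrite oM group1 => -[]. Qed.

Lemma sum_M1 (f : gT -> algC) :
  \sum_(y in M) f y = f 1%g + \sum_(y in M :\ 1%g) f y.
Proof.
by rewrite (bigD1 1%g) //=; congr (_ + _); apply: eq_bigl => y; rewrite !inE andbC.
Qed.

(** The left side is linear in d, A and the sum of squares, quantities that orthogonality evaluates
    or bounds after summing over [i]. Eigenvalue differences show that the fibre sums over y <> 1
    differ by multiples of m^2, which reduces the claim to [fibre_ineq_step]. *)
Lemma fibre_char_ineq (i : Iirr N) : i != 0 ->
  0 <= 4 * (r%:R - e i 1%g) * (m ^ 2)%:R
    - 3 * \sum_(y in M :\ 1%g) e i y * (e i y)^*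
    - (m ^ 2)%:R * \sum_(y in M :\ 1%g) e i y.
Proof.
move=> nz_i; set A := \sum_(y in M :\ 1%g) e i y.
have eigS := sum_fibres_eigen nz_i; have := eigS; rewrite sum_M1 -/A => eigSA.
have n3 : 3 != 0 :> algC by rewrite pnatr_eq0.
have n2 : 2 != 0 :> algC by rewrite pnatr_eq0.
have /fin_all_exists[z zP] y : exists z : int, y \in M :\ 1%g ->
    A = 2 * (e i y + (m ^ 2)%:R * z%:~R) /\
    ((e i 1%g + A = r%:R -> z = 0 \/ z = 1) /\
     (e i 1%g + A = r%:R - (3 * m ^ 2)%:R -> z = 0 \/ z = -1)).
  case: (boolP (y \in M :\ 1%g)) => [My1 | _]; last by exists 0.
  have [X eigX XE] := order3_eigen i My1.
  have [z zE [_ z1 z2]] := eigen_diff eigSA eigX; exists z => _; split=> //.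
  have {zE} : 2 * (e i 1%g + A) - 2 * X = 2 * (3 * (m ^ 2)%:R * z%:~R).
    by rewrite -mulrBr zE !intrM.
  rewrite XE -/A => zE; apply: (mulfI n3).
  transitivity (2 * (e i 1%g + A) - (2 * e i 1%g + 6 * e i y - A) + 6 * e i y); first ring.
  by rewrite zE; ring.
have [y0 My0] : exists y0, y0 \in M :\ 1%g.
  by apply/set0Pn; rewrite -card_gt0 card_M1.
(* T = A/2 does not depend on the choice of [y0]. *)
pose T := e i y0 + (m ^ 2)%:R * (z y0)%:~R.
have AT : A = 2 * T by have [] := zP y0 My0.
have eE y : y \in M :\ 1%g -> e i y = T - (m ^ 2)%:R * (z y)%:~R.
  move=> My; have [Ay _] := zP y My; apply/eqP; rewrite eq_sym subr_eq eq_sym; apply/eqP.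
  by apply: (mulfI n2); rewrite -Ay -AT.
(* Summing [eE] over the eight y gives 2T = 8T - m^2 (sum of z). Hence T is a rational algebraic
   integer, and m^2 divides it because m is prime to 6. *)
have T6 : 6%:R * T = ((m ^ 2)%:Z * \sum_(y in M :\ 1%g) z y)%:~R.
  have := AT; rewrite {1}/A (eq_bigr _ eE) big_split /= sumr_const card_M1 sumrN -mulr_sumr.
  rewrite intrM rmorph_sum /= => ATE.
  transitivity (T *+ 8 - 2 * T); first by rewrite -mulr_natr; ring.
  by rewrite -ATE; ring.
have AintT : T \in Aint.
  by rewrite rpredD ?rpredM ?fibre_char_Aint ?rpred_nat ?rpred_int.
have [dv6] := Aint_natmul_int AintT (isT : 0 < 6)%N T6.
set t := (_ %/ _)%Z => Tt.
have t6 : 6 * t = (m ^ 2)%:Z * \sum_(y in M :\ 1%g) z y.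
  by rewrite mulrC /t divzK.
have qt : ((m ^ 2)%:Z %| t)%Z.
  by apply: coprime6_sqr_dvdz => //; rewrite t6 dvdz_mulr.
have eint y : y \in M :\ 1%g -> e i y = (t - (m ^ 2)%:Z * z y)%:~R.
  by move=> My; rewrite eE // Tt intrB intrM.
have [s0 s0E s0P] : exists2 s0 : int, e i 1%g + A = s0%:~R &
    (s0 = r%:Z /\ forall y, y \in M :\ 1%g ->
      (m ^ 2)%:Z * z y = 0 \/ (m ^ 2)%:Z * z y = (m ^ 2)%:Z) \/
    (s0 = r%:Z - 3 * (m ^ 2)%:Z /\ forall y, y \in M :\ 1%g ->
      (m ^ 2)%:Z * z y = 0 \/ (m ^ 2)%:Z * z y = - (m ^ 2)%:Z).
  case: eigSA => SE.
    exists r%:Z => //; left; split=> // y /zP[_ [/(_ SE) + _]].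
    by case=> ->; rewrite ?mulr0 ?mulr1; [left | right].
  exists (r%:Z - 3 * (m ^ 2)%:Z); first by rewrite SE intrB intrM natrM.
  right; split=> // y /zP[_ [_ /(_ SE)]].
  by case=> ->; rewrite ?mulr0 ?mulrN1; [left | right].
have dE : e i 1%g = (s0 - 2 * t)%:~R by rewrite intrB intrM -s0E -Tt AT; ring.
have := fibre_ineq_step card_M1 (erefl (s0 - 2 * t))
  (fun y _ => erefl (t - (m ^ 2)%:Z * z y)) _ qt s0P.
rewrite -mulr_sumr t6 => /(_ erefl); rewrite -(ler0z algC).
have -> : \sum_(y in M :\ 1%g) e i y * (e i y)^* =
    (\sum_(y in M :\ 1%g) (t - (m ^ 2)%:Z * z y) ^+ 2)%:~R.
  rewrite rmorph_sum; apply: eq_bigr => y My; rewrite eint //.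
  by rewrite conj_intr ?intr_int // -intrM.
rewrite dE AT Tt !(intrB, intrM, rmorphN) /=; congr (_ <= _); ring.
Qed.

(** This is [order3_eigen] for the trivial character, with |F_1| eliminated through |D|; b is true
    when the eigenvalue is r - n. *)
Lemma fibre_card_eq y : y \in M :\ 1%g -> exists b : bool,
  (\sum_(z in M :\ 1%g) #|F z| = 2 * #|F y| + 2 * m ^ 2 * (r + b))%N.
Proof.
move=> My1; have [X eigX] := order3_eigen 0 My1.
have -> : \sum_(z in M :\ 1%g) e 0 z = (\sum_(z in M :\ 1%g) #|F z|)%:R.
  by rewrite natr_sum; apply: eq_bigr => z _; rewrite fibre_char0.
rewrite !fibre_char0; set A := (\sum_(z in _) _)%N => XE.
have tot : (#|F 1%g| + A = r * (3 * m ^ 2 + 1))%N.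
  rewrite -sum_fibres_card (bigD1 1%g) //=; congr (_ + _)%N.
  by apply: eq_bigl => z; rewrite !inE andbC.
have tot' : #|F 1%g|%:R = r%:R * (3 * m%:R ^+ 2 + 1) - A%:R :> algC.
  by apply/eqP; rewrite eq_sym subr_eq -natrD tot !(natrM, natrD, natrX).
have n3 : 3 != 0 :> algC by rewrite pnatr_eq0.
case: eigX XE => -> XE; [exists false | exists true];
  apply/eqP; rewrite -(eqr_nat algC); apply/eqP; apply: (mulfI n3).
  transitivity (2 * #|F 1%g|%:R + 6 * #|F y|%:R
    - (2 * #|F 1%g|%:R + 6 * #|F y|%:R - A%:R) + 2 * A%:R : algC); first ring.
  rewrite -XE tot' !(natrM, natrD, natrX) /=; ring.
transitivity (2 * #|F 1%g|%:R + 6 * #|F y|%:R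
    - (2 * #|F 1%g|%:R + 6 * #|F y|%:R - A%:R) + 2 * A%:R : algC); first ring.
rewrite -XE tot' !(natrM, natrD, natrX) /=; ring.
Qed.

(** Sum [fibre_char_ineq] over the nontrivial characters. The terms in d use 1 outside D, and the
    squares use Parseval. The terms in A are only bounded below, which suffices as they enter with a
    negative sign. *)
Lemma fibre_card_ineq :
  0 <= 4 * (m ^ 2)%:Z * (r%:Z * ((m ^ 4)%:Z - 1) + #|F 1%g|%:Z)
    - 3 * ((m ^ 4)%:Z * \sum_(y in M :\ 1%g) #|F y|%:Z
            - \sum_(y in M :\ 1%g) #|F y|%:Z ^+ 2)
    + (m ^ 2)%:Z * \sum_(y in M :\ 1%g) #|F y|%:Z.
Proof.
have sum_ineq := sumr_ge0 (index_enum (Iirr N)) fibre_char_ineq.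
have d_sum : \sum_(i : Iirr N | i != 0) e i 1%g = - #|F 1%g|%:R.
  have := sum_irr_set cNN (fibre_sub N D 1%g).
  rewrite inE mulg1 (negPf nD1) andbF mulr0n (bigD1 0) //= -/(e _ _) => /eqP.
  by rewrite -fibre_char0 addrC addr_eq0 => /eqP.
have A_sum y : - #|F y|%:R <= \sum_(i : Iirr N | i != 0) e i y.
  have := sum_irr_set cNN (fibre_sub N D y).
  rewrite (bigD1 0) //= irr0_sum_set ?fibre_sub // -/(e _ _) => E.
  by rewrite -subr_ge0 opprK addrC E -mulr_natr -natrM ler0n.
have Q_sum y : \sum_(i : Iirr N | i != 0) e i y * (e i y)^* =
    (m ^ 4)%:R * #|F y|%:R - #|F y|%:R ^+ 2.
  have := sum_irr_norm_set cNN (fibre_sub N D y).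
  rewrite (bigD1 0) //= irr0_sum_set ?fibre_sub // conjC_nat oN => <-.
  by rewrite expr2 [RHS]addrC addKr.
have card_nz : \sum_(i : Iirr N | i != 0) (1 : algC) = (m ^ 4)%:R - 1.
  have : \sum_(i : Iirr N) (1 : algC) = (m ^ 4)%:R.
    rewrite sumr_const card_ord NirrE -oN.
    by move: cNN; rewrite card_classes_abelian => /eqP ->.
  by rewrite (bigD1 0) //= => <-; rewrite [RHS]addrC addKr.
move: sum_ineq; rewrite !big_split /= !sumrN -!mulr_sumr -mulr_suml -mulr_sumr.
rewrite big_split /= sumrN d_sum -(mulr1 r%:R) -mulr_sumr card_nz.
rewrite exchange_big /= (eq_bigr _ (fun y _ => Q_sum y)) [X in _ - _ * X]exchange_big /=.
move=> H; rewrite -(ler0z algC); apply: le_trans H _.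
set B := \sum_(y in _) \sum_(i | _) _; set S := \sum_(y in M :\ 1%g) #|F y|%:Z.
have B_ge : - S%:~R <= B.
  by rewrite rmorph_sum -sumrN ler_sum // => y _; apply: A_sum.
rewrite big_split /= sumrN -mulr_sumr -subr_ge0.
set Q := \sum_(y in _) #|F y|%:Z ^+ 2.
have -> : \sum_(y in M :\ 1%g) #|F y|%:R ^+ 2 = Q%:~R :> algC.
  by rewrite rmorph_sum; apply: eq_bigr => y _; rewrite rmorphXn.
have -> : \sum_(y in M :\ 1%g) #|F y|%:R = S%:~R :> algC by rewrite rmorph_sum.
rewrite (_ : _ - _ = (m ^ 2)%:R * (B + S%:~R)); last first.
  by rewrite !(intrD, intrB, intrM, rmorphN) /= -!pmulrn; ring.
by rewrite mulr_ge0 ?ler0n // -[S%:~R]opprK subr_ge0.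
Qed.

Lemma NLS_parameter : (2 * r)%:Z = (3 * m ^ 2)%:Z - 1 \/ (2 * r)%:Z = (3 * m ^ 2)%:Z - 3.
Proof.
(* For m = 1 the bounds force r = 1 and 2r = n - 1. Otherwise m >= 5, whence q >= 25 below. *)
have [m_le | m_gt] := leqP m 1.
  by have m1 : m = 1%N by [lia]; move: r_le; rewrite m1 => ?; left; lia.
have m_ge : (5 <= m)%N.
  case: m m_gt odd_m co3m => [|[|[|[|[|k]]]]] //.
have /fin_all_exists[c cP] y : exists c : bool, y \in M :\ 1%g ->
    (\sum_(z in M :\ 1%g) #|F z| = 2 * #|F y| + 2 * m ^ 2 * (r + c))%N.
  case: (boolP (y \in M :\ 1%g)) => [/fibre_card_eq[c ->] | _]; last by exists true.
  by exists c.
have sumZ : (\sum_(y in M :\ 1%g) #|F y|)%N%:Z = \sum_(y in M :\ 1%g) #|F y|%:Z.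
  by rewrite -natz natr_sum; apply: eq_bigr => y _; rewrite natz.
set q := (m ^ 2)%:Z; set A := \sum_(y in M :\ 1%g) #|F y|%:Z in sumZ.
have tot : #|F 1%g|%:Z = r%:Z * (3 * q + 1) - A.
  have := sum_fibres_card; rewrite (bigD1 1%g) //=.
  rewrite (eq_bigl (mem (M :\ 1%g))) => [|y]; last by rewrite !inE andbC.
  move/(congr1 Posz); rewrite PoszD sumZ => totE.
  by apply: (addIr A); rewrite totE subrK !PoszM.
have [y0 My0] : exists y0, y0 \in M :\ 1%g.
  by apply/set0Pn; rewrite -card_gt0 card_M1.
(* B is the common value of |F_y| + q c(y) over y <> 1. *)
pose B := #|F y0|%:Z + q * (c y0)%:Z.
have AB : A = 2 * B + 2 * q * r%:Z.
  by rewrite -sumZ (cP y0 My0) !(PoszD, PoszM) -/q /B; ring.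
have FE y : y \in M :\ 1%g -> #|F y|%:Z = B - q * (c y)%:Z.
  move=> My; have := AB; rewrite -sumZ (cP y My) !(PoszD, PoszM) -/q; lia.
pose E := \sum_(y in M :\ 1%g) (c y)%:Z.
have AE : A = 8 * B - q * E.
  rewrite /A (eq_bigr _ FE) big_split /= sumr_const card_M1 sumrN -mulr_sumr.
  by rewrite -/E; ring.
have QE : \sum_(y in M :\ 1%g) #|F y|%:Z ^+ 2 = 8 * B ^+ 2 + (q ^+ 2 - 2 * B * q) * E.
  rewrite (eq_bigr (fun y => B ^+ 2 + (q ^+ 2 - 2 * B * q) * (c y)%:Z)); last first.
    by move=> y My; rewrite FE //; case: (c y) => /=; ring.
  by rewrite big_split /= sumr_const card_M1 -mulr_sumr -/E; ring.
have E_ge : 0 <= E by apply: sumr_ge0.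
have E_le : E <= 8.
  rewrite -[8]/(8%:Z) -card_M1 -sum1_card -natz natr_sum ler_sum // => y _.
  by case: (c y).
have B6 : 6 * B = q * (2 * r%:Z + E).
  have: 8 * B - q * E = 2 * B + 2 * q * r%:Z by rewrite -AE.
  lia.
have /dvdzP[b bE] : (q %| B)%Z.
  by apply: coprime6_sqr_dvdz => //; rewrite B6 dvdz_mulr.
have q_ge : 25 <= q by rewrite /q lez_nat (@leq_exp2r 5 m 2).
have q0 : q != 0 by lia.
(* So 3b - r = E/2 lies between 0 and 4: it is the eps of [NLS_final_arith]. *)
have Eb : E = 6 * b - 2 * r%:Z.
  by apply: (mulfI q0); move: B6; rewrite bE; lia.
have := fibre_card_ineq.
rewrite tot -/A -/q QE AE bE Eb (_ : (m ^ 4)%:Z = q ^+ 2); last first.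
  by rewrite expr2 /q -PoszM -expnD.
set lhs := (X in 0 <= X) => lhs_ge.
have lhsE : lhs = q ^+ 2 * 2 *
    (6 * b * (2 * b - q + 1 - (3 * b - r%:Z)) + q * (3 * b - r%:Z)).
  by rewrite /lhs; ring.
have ineq : 0 <= 6 * b * (2 * b - q + 1 - (3 * b - r%:Z)) + q * (3 * b - r%:Z).
  by move: lhs_ge; rewrite lhsE pmulr_rge0 // mulr_gt0 // exprn_gt0 //; lia.
have r_leZ : 2 * r%:Z <= 3 * q - 1 by rewrite /q; lia.
have := @NLS_final_arith q b (3 * b - r%:Z) r%:Z _ q_ge _ _ r_leZ _ ineq.
rewrite !PoszM -/q; apply.
- by rewrite /q /= oddX odd_m.
- by apply/andP; split; lia.
- by lia.
- by ring.
Qed.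

End NLS.

(** * Splitting off the Sylow 3-subgroup, and the two families of orders *)

Lemma NLS_PDS_parameter (gT : finGroupType) (G : {group gT}) (D : {set gT}) (m r : nat) :
     abelian G -> (0 < m)%N -> odd m -> coprime 3 m ->
     (1 <= r)%N -> (2 * r <= 3 * m ^ 2 - 1)%N ->
     is_regular_PDS G D (9 * m ^ 4) (r * (3 * m ^ 2 + 1))
       (- (3 * m ^ 2)%:Z + (r ^ 2)%:Z + (3 * r)%:Z) ((r ^ 2 + r)%:Z) ->
  (2 * r)%:Z = (3 * m ^ 2)%:Z - 1 \/ (2 * r)%:Z = (3 * m ^ 2)%:Z - 3.
Proof.
move=> cGG m_gt0 odd_m co3m r_gt0 r_le pdsD.
have oG : #|G| = (9 * m ^ 4)%N by case: pdsD => [[]].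
have defG : ('O_(3%N^')(G) \x 'O_(3%N)(G) = G)%g.
  by rewrite dprodC nilpotent_pcoreC // abelian_nil.
have oM : #|'O_(3%N)(G)%g| = 9%N.
  rewrite (card_Hall (nilpotent_pcore_Hall 3%N (abelian_nil cGG))) oG.
  rewrite partnM ?expn_gt0 ?m_gt0 // (@part_pnat_id 3%N 9) // part_p'nat ?muln1 //.
  by rewrite pnatX orbC p'natE // -prime_coprime // co3m.
have oN : #|'O_(3%N^')(G)%g| = (m ^ 4)%N.
  by apply/eqP; rewrite -(@eqn_pmul2r 9) // -{1}oM (dprod_card defG) oG mulnC.
exact: (NLS_parameter cGG defG oM oN m_gt0 odd_m co3m r_gt0 r_le pdsD).
Qed.

Theorem theorem8 :
  (forall (gT : finGroupType) (G : {group gT}) (D : {set gT}) (m r : nat),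
     abelian G -> (0 < m)%N -> odd m -> coprime 3 m ->
     (1 <= r)%N -> (2 * r <= 3 * m ^ 2 - 1)%N ->
     is_regular_PDS G D (9 * m ^ 4) (r * (3 * m ^ 2 + 1))
       (- (3 * m ^ 2)%:Z + (r ^ 2)%:Z + (3 * r)%:Z) ((r ^ 2 + r)%:Z) ->
     (4 * r)%:Z = (3 * m ^ 2)%:Z - 3 \/ (4 * r)%:Z = (3 * m ^ 2)%:Z + 1 \/
     (4 * r)%:Z = (3 * m ^ 2)%:Z + 5 \/ (2 * r)%:Z = (3 * m ^ 2)%:Z - 5 \/
     (2 * r)%:Z = (3 * m ^ 2)%:Z - 3 \/ (2 * r)%:Z = (3 * m ^ 2)%:Z - 1)
  /\
  (forall (gT : finGroupType) (G : {group gT}) (D : {set gT}) (p s r : nat),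
     abelian G -> prime p -> (p %% 4 = 1)%N -> (0 < s)%N -> odd s ->
     (1 <= r)%N -> (2 * r <= 3 * p ^ (2 * s) - 1)%N ->
     is_regular_PDS G D (9 * p ^ (4 * s)) (r * (3 * p ^ (2 * s) + 1))
       (- (3 * p ^ (2 * s))%:Z + (r ^ 2)%:Z + (3 * r)%:Z) ((r ^ 2 + r)%:Z) ->
     [\/ (4 * r)%:Z = (3 * p ^ (2 * s))%:Z + 1,
         (2 * r)%:Z = (3 * p ^ (2 * s))%:Z - 1
       | (2 * r)%:Z = (3 * p ^ (2 * s))%:Z - 3]).
Proof.
split=> [gT G D m r cGG m_gt0 odd_m co3m r_gt0 r_le pdsD|].
  by have [] := NLS_PDS_parameter cGG m_gt0 odd_m co3m r_gt0 r_le pdsD; tauto.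
move=> gT G D p s r cGG pr_p p1 s_gt0 _ r_gt0.
(* Rewrites the parameters for m = p^s; p = 1 modulo 4 makes p odd and different from 3. *)
rewrite ![(_ * s)%N]mulnC !expnM => r_le pdsD.
have odd_ps : odd (p ^ s) by rewrite oddX; apply/orP; right; lia.
have co3 : coprime 3 (p ^ s).
  by rewrite coprimeXr // prime_coprime // dvdn_prime2 //; apply/eqP => p3; rewrite -p3 in p1.
have ps_gt0 : (0 < p ^ s)%N by rewrite expn_gt0 prime_gt0.
have [] := NLS_PDS_parameter cGG ps_gt0 odd_ps co3 r_gt0 r_le pdsD => ->.
  by apply: Or32.
by apply: Or33.
Qed.
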